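(* Let $C>0$ be a given constant, let $0<\varepsilon_g<1/2$, and let $0<a_1<a_2$ be constants. Let $\xi_1,\dots,\xi_n$ be i.i.d. copies of a subgaussian random variable with mean zero and variance one. Assume $a_1N\le x\le a_2N$ and $x\le\sqrt n-N^{\varepsilon_g}$. Then for $\delta=N^{-C}$ and any open ball (interval) $B(a,\delta)\subset\mathbb R$, \[\mathbb P\big(P_n(x)\in B(a,\delta)\big)=O(\delta),\] where $P_n(x)=e^{-x^2/2}\sum_{i=1}^n\xi_i x^i/\sqrt{i!}$.
   Context: $N$ is a large parameter with $N\le\sqrt n$ (in the paper $N=M$, the scale of the interval $[c_1M,c_2M]\subset[0,\sqrt n-M]$); implied constants may depend on $C,\varepsilon_g,a_1,a_2$ and the law of $\xi$. Equivalently $P_n(x)=\frac1{\sqrt N}\sum_{i=1}^n\xi_ib_i(x)$ with $b_i(x)=\sqrt N e^{-x^2/2}x^i/\sqrt{i!}$. *)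

(* Defs.v *)
From HB Require Import structures.
From mathcomp Require Import all_boot all_order all_algebra.
From mathcomp Require Import all_classical all_reals all_analysis.
Set Implicit Arguments. Unset Strict Implicit. Unset Printing Implicit Defensive.
Import Order.TTheory GRing.Theory Num.Theory.
Import numFieldNormedType.Exports.
Local Open Scope classical_set_scope.
Local Open Scope ring_scope.

Definition mutually_independent d (T : measurableType d) (R : realType)
  (P : probability T R) (X : nat -> {RV P >-> R}) : Prop :=
  forall (s : seq nat) (B : nat -> set R), uniq s ->
    (forall i, measurable (B i)) ->
    P (\bigcap_(i in [set` s]) (X i @^-1` B i)) =
    (\big[*%E/1%E]_(i <- s) P (X i @^-1` B i))%E.

Definition identically_distributed d (T : measurableType d) (R : realType)
  (P : probability T R) (X : nat -> {RV P >-> R}) : Prop :=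
  forall i (A : set R), measurable A ->
    distribution P (X i) A = distribution P (X 0%N) A.

Definition iid d (T : measurableType d) (R : realType)
  (P : probability T R) (X : nat -> {RV P >-> R}) : Prop :=
  mutually_independent X /\ identically_distributed X.

Definition subgaussian d (T : measurableType d) (R : realType)
  (P : probability T R) (Y : {RV P >-> R}) : Prop :=
  exists c : R, 0 < c /\ forall t : R, 0 < t ->
    (P [set w | (t <= `|Y w|)%R ] <= (2 * expR (- t ^+ 2 / c ^+ 2))%:E)%E.

Definition Pn d (T : measurableType d) (R : realType)
  (P : probability T R) (xi : nat -> {RV P >-> R}) (n : nat) (x : R) (w : T) : R :=
  expR (- x ^+ 2 / 2) *
  \sum_(1 <= i < n.+1) xi i w * x ^+ i / Num.sqrt (i`!)%:R.

(* Main.v *)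
(** Write [c_i = e^(-x^2/2) x^i / sqrt(i!)], so that [c_i^2] is the Poisson
    weight of mean [x^2]. A discrete Esseen inequality at the integer frequencies
    [m < N^C] reduces the bound to showing that the product of the [|phi(m c_i)|]
    is at most [e^(-c m) + N^(-C)], where [phi] is the characteristic function of
    [xi]. Mean zero and variance one give [|phi(s)|^2 <= e^(-c s^2)] for
    [|s| <= s0], and one only keeps the indices with [m c_i <= s0]. Either these
    are all the indices below some [K <= n] carrying half of the Poisson mass; or
    the weights, which decrease slowly and become smaller than any power of [1/N]
    before index [n], must cross the level [(s0/m)^2], and about [N^(1-eps)] of
    them lie between half this level and this level. In both cases the energy
    [m^2 sum c_i^2] over the kept indices is large enough. *)

Require Import Defs.
From HB Require Import structures.
From mathcomp Require Import all_boot all_order all_algebra.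
From mathcomp Require Import all_classical all_reals all_analysis.
From mathcomp Require Import measurable_realfun ring lra.
Set Implicit Arguments. Unset Strict Implicit. Unset Printing Implicit Defensive.
Import Order.TTheory GRing.Theory Num.Theory.
Import numFieldNormedType.Exports.
Local Open Scope classical_set_scope.
Local Open Scope ring_scope.

(** * Uniqueness of finite measures on products, and bounded integrands *)

Lemma rectangle_measure_unique (R : realType) d1 d2 (T1 : measurableType d1)
  (T2 : measurableType d2) (m1 m2 : {measure set (T1 * T2) -> \bar R}) :
  (m1 setT < +oo)%E ->
  (forall A B, measurable A -> measurable B -> m1 (A `*` B) = m2 (A `*` B)) ->
  forall D, measurable D -> m1 D = m2 D.
Proof.
move=> fin1 m12 D mD.
pose C : set (set (T1 * T2)) :=
  [set C | exists A, measurable A /\ exists B, measurable B /\ C = A `*` B].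
(* Rectangles are stable under intersection and generate the product sigma-algebra; the constant
   cover by [setT] is admissible because [m1 setT] is finite. *)
apply: (measure_unique C (fun=> setT)) => //.
- rewrite measurable_prod_measurableType //; congr (<<s _ >>).
  rewrite predeqE; split => [[A mA [B mB <-]]|[A [mA [B [mB ->]]]]].
    by exists A; split => //; exists B.
  by exists A => //; exists B.
- move=> _ _ [X1 [mX1 [X2 [mX2 ->]]]] [Y1 [mY1 [Y2 [mY2 ->]]]].
  rewrite -setXI; exists (X1 `&` Y1); split; first exact: measurableI.
  by exists (X2 `&` Y2); split => //; exact: measurableI.
- by move=> _; exists setT; split=> //; exists setT; split=> //; rewrite setXTT.
- by rewrite bigcup_const.
- by move=> _ [A [mA [B [mB ->]]]]; exact: m12.
Qed.

Lemma integrable_bounded d (T : measurableType d) (R : realType)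
  (P : probability T R) (f : T -> R) (K : R) : measurable_fun setT f ->
  (forall w, `|f w| <= K) -> P.-integrable setT (EFin \o f).
Proof.
move=> mf fK; apply: measurable_bounded_integrable => //.
  exact: le_lt_trans (probability_le1 P measurableT) (ltry _).
exists K; split; first exact: num_real.
by move=> M KM w _ /=; rewrite (le_trans (fK w))// ltW.
Qed.

(** * Independent pairs: joint events and expectations of products *)

Section independence.
Context d (T : measurableType d) (R : realType) (P : probability T R).

Definition indep_pair (X Y : {RV P >-> R}) := forall A B : set R,
  measurable A -> measurable B ->
  P (X @^-1` A `&` Y @^-1` B) = (P (X @^-1` A) * P (Y @^-1` B))%E.

(** As functions of [D] both sides are finite measures: the restriction of [P] to [E] transported by
    the pair, and the law of the pair scaled by [P E]. They agree on rectangles by hypothesis. *)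
Lemma indep_pair_event (X Y : {RV P >-> R}) (E : set T) (D : set (R * R)) :
  measurable E -> measurable D -> indep_pair X Y ->
  (forall A B, measurable A -> measurable B ->
    P (X @^-1` A `&` Y @^-1` B `&` E) =
      (P (X @^-1` A) * P (Y @^-1` B) * P E)%E) ->
  P ((fun w => (X w, Y w)) @^-1` D `&` E) =
    (P ((fun w => (X w, Y w)) @^-1` D) * P E)%E.
Proof.
move=> mE mD XY XYE.
have mXY : measurable_fun setT (fun w => (X w, Y w)).
  exact: measurable_fun_pair.
pose Z : {mfun T >-> (R * R)%type} := HB.pack (fun w => (X w, Y w))
  (isMeasurableFun.Build _ _ _ _ _ mXY).
pose r : {nonneg R} := NngNum (fine_ge0 (measure_ge0 P E)).
have rE : (r%:num)%:E = P E by rewrite /= fineK// fin_num_measure.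
pose m1 : {measure set (R * R) -> \bar R} := pushforward (mrestr P mE) Z.
pose m2 : {measure set (R * R) -> \bar R} := mscale r (distribution P Z).
have m1E A : m1 mXY A = P (Z @^-1` A `&` E) by [].
have m2E A : m2 A = (P (Z @^-1` A) * P E)%E by rewrite muleC -rE.
have := @rectangle_measure_unique R _ _ _ _ (m1 mXY) m2 _ _ D mD.
rewrite m1E m2E; apply.
  suff : (P (Z @^-1` setT `&` E) < +oo)%E by [].
  by rewrite preimage_setT setTI (le_lt_trans (probability_le1 _ _))// ltry.
move=> A B mA mB.
suff : P (Z @^-1` (A `*` B) `&` E) = (P (Z @^-1` (A `*` B)) * P E)%E.
  by rewrite -m2E.
have -> : Z @^-1` (A `*` B) = X @^-1` A `&` Y @^-1` B by [].
by rewrite XYE// XY.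
Qed.

(** The law of the pair is the product of the two laws, so Fubini separates the integral;
    boundedness supplies all the integrability conditions. *)
Lemma indep_pair_expectation (X Y : {RV P >-> R}) (f g : R -> R) (K : R) :
  indep_pair X Y -> measurable_fun setT f -> measurable_fun setT g ->
  (forall x, `|f x| <= K) -> (forall x, `|g x| <= K) ->
  \int[P]_w (f (X w) * g (Y w)) =
    (\int[P]_w f (X w)) * (\int[P]_w g (Y w)).
Proof.
move=> XY mf mg fK gK.
have mXY : measurable_fun setT (fun w => (X w, Y w)).
  exact: measurable_fun_pair.
pose Z : {mfun T >-> (R * R)%type} := HB.pack (fun w => (X w, Y w))
  (isMeasurableFun.Build _ _ _ _ _ mXY).
pose F (z : R * R) := f z.1 * g z.2.
have mF : measurable_fun setT F.
  by apply: measurable_funM; exact: measurableT_comp.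
have FK z : `|F z| <= K * K by rewrite normrM ler_pM.
have mX : measurable_fun setT X by [].
have mY : measurable_fun setT Y by [].
have mfX : measurable_fun setT (f \o X) by exact: measurableT_comp.
have mgY : measurable_fun setT (g \o Y) by exact: measurableT_comp.
have ifX : P.-integrable setT (EFin \o (f \o X)).
  by apply: (@integrable_bounded _ _ _ _ _ K) => // w /=.
have igY : P.-integrable setT (EFin \o (g \o Y)).
  by apply: (@integrable_bounded _ _ _ _ _ K) => // w /=.
have iF : P.-integrable setT (EFin \o (F \o Z)).
  apply: (@integrable_bounded _ _ _ _ (F \o Z) (K * K)) => [|w]; last exact: FK.
  exact: (measurableT_comp mF mXY).
have ZE D : measurable D ->
    distribution P Z D = (distribution P X \x distribution P Y)%E D.
  move=> mD; apply/esym; apply: product_measure_unique => //.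
rewrite /Rintegral -fineM ?integrable_fin_num//; congr fine.
have -> : (\int[P]_x (f (X x) * g (Y x))%:E = \int[P]_x (EFin \o F \o Z) x)%E by [].
transitivity (\int[distribution P Z]_z (EFin (F z)))%E.
  by rewrite integral_distribution//; exact/measurable_EFinP.
transitivity (\int[(distribution P X \x distribution P Y)%E]_z (EFin (F z)))%E.
  by apply: eq_measure_integral => A mA _; exact: ZE.
rewrite -integral12_prod_meas1/=; last first.
  apply: measurable_bounded_integrable => //.
    suff : ((distribution P X \x distribution P Y) setT < +oo)%E by [].
    rewrite -ZE//.
    exact: le_lt_trans (probability_le1 (distribution P Z) measurableT) (ltry _).
  exists (K * K); split; first exact: num_real.
  by move=> M KM w _ /=; rewrite (le_trans (FK w))// ltW.
rewrite /fubini_F.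
have igD : (distribution P Y).-integrable setT (EFin \o g).
  exact: (@integrable_bounded _ _ _ _ _ K).
transitivity (\int[distribution P X]_x
    ((f x)%:E * \int[distribution P Y]_y (g y)%:E))%E.
  apply: eq_integral => x _; rewrite -integralZl//.
have gE : (\int[distribution P Y]_y (g y)%:E)%E =
    (fine (\int[distribution P Y]_y (g y)%:E))%:E.
  by rewrite fineK// integrable_fin_num.
rewrite gE integralZr//; last exact: (@integrable_bounded _ _ _ _ _ K).
by rewrite -gE !integral_distribution//; exact/measurable_EFinP.
Qed.
End independence.

(** * Weighted sums of independent variables and their characteristic functions *)

Section characteristic_function.
Context d (T : measurableType d) (R : realType) (P : probability T R).
Implicit Types (X : nat -> {RV P >-> R}) (c : nat -> R).

Definition wsum c X (k : nat) (w : T) : R := \sum_(i < k) c i * X i w.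

Lemma measurable_wsum c X k : measurable_fun setT (wsum c X k).
Proof.
apply: measurable_sum => i; apply: measurable_funM => //.
Qed.

HB.instance Definition _ c X k :=
  isMeasurableFun.Build _ _ _ _ (wsum c X k) (measurable_wsum c X k).

Lemma wsumS c X k w : wsum c X k.+1 w = wsum c X k w + c k * X k w.
Proof. by rewrite /wsum big_ord_recr. Qed.

(* The induction adds [X k] to the sum while keeping all the later variables in a
   single event, which is why independence of pairs would not be enough. *)
Lemma wsum_indep_tail c X k (s : seq nat) (A : set R) (B : nat -> set R) :
  mutually_independent X -> uniq s -> all (leq k) s ->
  measurable A -> (forall i, measurable (B i)) ->
  P (wsum c X k @^-1` A `&` \bigcap_(i in [set` s]) (X i @^-1` B i)) =
  (P (wsum c X k @^-1` A) * P (\bigcap_(i in [set` s]) (X i @^-1` B i)))%E.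
Proof.
move=> Xind; elim: k s A B => [|k IH] s A B us ks mA mB.
  have [A0|A0] := pselect (A 0).
    rewrite (_ : _ @^-1` A = setT) ?setTI ?probability_setT ?mul1e//.
    by apply/seteqP; split => w //= _; rewrite /wsum big_ord0.
  rewrite (_ : _ @^-1` A = set0) ?set0I ?measure0 ?mul0e//.
  by apply/seteqP; split => w //=; rewrite /wsum big_ord0.
have kNs : k \notin s by apply/negP => /(allP ks); rewrite ltnn.
have uks : uniq (k :: s) by rewrite /= kNs.
have kks : all (leq k) (k :: s).
  by rewrite /= leqnn; apply: sub_all ks => i; exact: ltnW.
set E := \bigcap_(i in _) _.
have mE : measurable E by apply: bigcap_measurableType => i _; exact: measurable_funPTI.
(* An event of [X k] is merged with the tail event, so that the induction hypothesis can be applied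
   to the longer list [k :: s]. *)
have cap_cons B0 : X k @^-1` B0 `&` E =
    \bigcap_(i in [set` k :: s]) (X i @^-1` (if i == k then B0 else B i)).
  apply/seteqP; split => w.
    move=> [Bk Ew] i /=; rewrite inE => /predU1P[->|si]; first by rewrite eqxx.
    case: eqP => [->//|_]; exact: Ew.
  move=> h; split; first by have := h k; rewrite /= eqxx; apply; rewrite inE eqxx.
  move=> i /= si; have := h i; rewrite /= inE si orbT => /(_ isT).
  by case: eqP => // ik; rewrite ik (negbTE kNs) in si.
have mB' B0 : measurable B0 -> forall i, measurable (if i == k then B0 else B i).
  by move=> mB0 i; case: ifP.
have indE B0 : measurable B0 -> P (X k @^-1` B0 `&` E) = (P (X k @^-1` B0) * P E)%E.
  move=> mB0; rewrite cap_cons Xind//; last exact: mB'.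
  rewrite big_cons eqxx; congr (_ * _)%E; rewrite /E Xind//.
  apply: eq_big_seq => i si; case: eqP => // ik.
  by rewrite ik (negbTE kNs) in si.
have XS A0 B0 : measurable A0 -> measurable B0 ->
    P (wsum c X k @^-1` A0 `&` X k @^-1` B0 `&` E) =
    (P (wsum c X k @^-1` A0) * P (X k @^-1` B0) * P E)%E.
  move=> mA0 mB0; rewrite -setIA cap_cons IH//; last exact: mB'.
  by rewrite -cap_cons indE// muleA.
have XS1 : indep_pair (wsum c X k) (X k).
  move=> A0 B0 mA0 mB0; have := IH [:: k] A0 (fun=> B0) isT.
  rewrite /= leqnn (_ : \bigcap_(i in _) _ = X k @^-1` B0); first exact.
  apply/seteqP; split => w /=; first by apply; rewrite /= inE.
  by move=> ? i /=; rewrite inE => /eqP ->.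
(* The next partial sum is [g] of the pair, so each of its events is a planar event of the pair, as
   [indep_pair_event] requires. *)
pose g (z : R * R) := z.1 + c k * z.2.
have mg : measurable_fun setT g.
  apply: measurable_funD => //; apply: measurable_funM => //.
have mD : measurable (g @^-1` A) by rewrite -[X in measurable X]setTI; exact: mg.
have := @indep_pair_event _ _ _ P (wsum c X k) (X k) E _ mE mD XS1 XS.
rewrite (_ : _ @^-1` (g @^-1` A) = wsum c X k.+1 @^-1` A)//.
by apply/seteqP; split => w; rewrite /= /g /= wsumS.
Qed.

Lemma wsum_indep c X k : mutually_independent X -> indep_pair (wsum c X k) (X k).
Proof.
move=> Xind A B mA mB.
have := @wsum_indep_tail c X k [:: k] A (fun=> B) Xind isT.
rewrite /= leqnn (_ : \bigcap_(i in _) _ = X k @^-1` B); first exact.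
apply/seteqP; split => w /=; first by apply; rewrite /= inE.
by move=> ? i /=; rewrite inE => /eqP ->.
Qed.

(* The squared modulus of the characteristic function. *)
Definition chf2 (Y : T -> R) (t : R) : R :=
  (\int[P]_w cos (t * Y w)) ^+ 2 + (\int[P]_w sin (t * Y w)) ^+ 2.

Lemma measurable_cos_mul (t : R) : measurable_fun setT (fun y : R => cos (t * y)).
Proof.
apply: (@measurableT_comp _ _ _ _ _ _ cos).
  by apply: continuous_measurable_fun; exact: continuous_cos.
by apply: measurable_funM.
Qed.

Lemma measurable_sin_mul (t : R) : measurable_fun setT (fun y : R => sin (t * y)).
Proof.
apply: (@measurableT_comp _ _ _ _ _ _ sin).
  by apply: continuous_measurable_fun; exact: continuous_sin.
by apply: measurable_funM.
Qed.

Lemma integrable_bounded_comp (Y : {RV P >-> R}) (f : R -> R) (K : R) :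
  measurable_fun setT f -> (forall y, `|f y| <= K) ->
  P.-integrable setT (EFin \o (f \o Y)).
Proof.
move=> mf fK; apply: (@integrable_bounded _ _ _ _ _ K) => [|w]; last exact: fK.
exact: measurableT_comp.
Qed.

Lemma integrable_cos_sin (X Y : {RV P >-> R}) (s t : R) (f g : R -> R) :
  (forall t, measurable_fun setT (fun y : R => f (t * y))) ->
  (forall t, measurable_fun setT (fun y : R => g (t * y))) ->
  (forall y, `|f y| <= 1) -> (forall y, `|g y| <= 1) ->
  P.-integrable setT (EFin \o (fun w => f (s * X w) * g (t * Y w))).
Proof.
move=> mf mg f1 g1; apply: (@integrable_bounded _ _ _ _ _ 1) => [|w].
  by apply: measurable_funM; [apply: (measurableT_comp (mf s))
    |apply: (measurableT_comp (mg t))].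
by rewrite normrM mulr_ile1.
Qed.

(** The addition formulas and the factorisation of expectations give the real and imaginary parts of
    a product of two complex numbers, and the squared modulus is multiplicative. *)
Lemma chf2_add (X Y : {RV P >-> R}) (c t : R) : indep_pair X Y ->
  chf2 (fun w => X w + c * Y w) t = chf2 X t * chf2 Y (t * c).
Proof.
move=> XY; rewrite /chf2.
have ee (f g : R -> R) : (forall t, measurable_fun setT (fun y : R => f (t * y))) ->
  (forall t, measurable_fun setT (fun y : R => g (t * y))) ->
  (forall y, `|f y| <= 1) -> (forall y, `|g y| <= 1) ->
  \int[P]_w (f (t * X w) * g (t * c * Y w)) =
  (\int[P]_w f (t * X w)) * (\int[P]_w g (t * c * Y w)).
  move=> mf mg f1 g1.
  exact: (@indep_pair_expectation _ _ _ P X Y (fun y => f (t * y))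
    (fun y => g (t * c * y)) 1).
have mc := measurable_cos_mul; have ms := measurable_sin_mul.
have c1 := @cos_max R; have s1 := @sin_max R.
have -> : \int[P]_w cos (t * (X w + c * Y w)) =
    \int[P]_w cos (t * X w) * \int[P]_w cos (t * c * Y w) -
    \int[P]_w sin (t * X w) * \int[P]_w sin (t * c * Y w).
  rewrite -ee// -ee// -RintegralB//; try exact: integrable_cos_sin.
  by apply: eq_Rintegral => w _; rewrite mulrDr mulrA cosD.
have -> : \int[P]_w sin (t * (X w + c * Y w)) =
    \int[P]_w sin (t * X w) * \int[P]_w cos (t * c * Y w) +
    \int[P]_w cos (t * X w) * \int[P]_w sin (t * c * Y w).
  rewrite -ee// -ee// -RintegralD//; try exact: integrable_cos_sin.
  by apply: eq_Rintegral => w _; rewrite mulrDr mulrA sinD.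
ring.
Qed.

Lemma chf2_eq_distribution (X Y : {RV P >-> R}) t :
  (forall A : set R, measurable A -> distribution P X A = distribution P Y A) ->
  chf2 X t = chf2 Y t.
Proof.
move=> XY.
have ee (f : R -> R) : measurable_fun setT f -> (forall y, `|f y| <= 1) ->
    \int[P]_w f (X w) = \int[P]_w f (Y w).
  move=> mf f1; rewrite /Rintegral; congr fine.
  have h (Z : {RV P >-> R}) :
      (\int[P]_w (f (Z w))%:E = \int[distribution P Z]_y (EFin \o f) y)%E.
    rewrite integral_distribution//; first exact/measurable_EFinP.
    have := @integrable_bounded_comp Z f 1 mf f1.
    exact.
  by rewrite !h; apply: eq_measure_integral => A mA _; exact: XY.
rewrite /chf2 (ee (fun y => cos (t * y))) ?(ee (fun y => sin (t * y)))//.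
- exact: measurable_sin_mul.
- by move=> y; exact: sin_max.
- exact: measurable_cos_mul.
- by move=> y; exact: cos_max.
Qed.

Lemma chf2_wsum c X k t : iid X ->
  chf2 (wsum c X k) t = \prod_(i < k) chf2 (X 0%N) (t * c i).
Proof.
move=> [Xind Xid]; elim: k => [|k IH].
  rewrite big_ord0 /chf2.
  have h (f : R -> R) : \int[P]_w f (t * wsum c X 0 w) = f 0.
    transitivity (\int[P]_w (cst (f 0) w)).
      by apply: eq_Rintegral => w _; rewrite /wsum big_ord0 mulr0.
    by rewrite Rintegral_cst//= probability_setT mulr1.
  by rewrite !h cos0 sin0 expr1n expr0n addr0.
rewrite big_ord_recr /= -IH -(@chf2_eq_distribution (X k) (X 0%N)); last first.
  by move=> A mA; exact: Xid.
rewrite -chf2_add; last exact: wsum_indep.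
by congr chf2; apply/funext => w; rewrite wsumS.
Qed.

End characteristic_function.

(** * Elementary quadratic bounds for sine and cosine *)

Section trigonometric_bounds.
Variable R : realType.
Implicit Types y z : R.

Lemma norm_sin_le y : `|sin y| <= `|y|.
Proof.
wlog y0 : y / 0 <= y.
  move=> h; have [/h//|yN] := leP 0 y.
  by rewrite -normrN -sinN -(normrN y) h// oppr_ge0 ltW.
have [c _] := @MVT_segment R sin cos 0 y y0
  (fun x _ => is_derive_sin x) (continuous_subspaceT (@continuous_sin R)).
rewrite sin0 !subr0 => ->; rewrite normrM ler_piMl//; exact: cos_max.
Qed.

Lemma one_sub_cosE y : 1 - cos y = 2 * sin (y / 2) ^+ 2.
Proof.
rewrite [in LHS](_ : y = (y / 2) *+ 2); last by rewrite -mulr_natr divfK.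
by rewrite cos_mulr2n cos2sin2; ring.
Qed.

Lemma one_sub_cos_le y : 1 - cos y <= y ^+ 2 / 2.
Proof.
rewrite one_sub_cosE -(real_normK (num_real (sin (_ / 2)))).
have := norm_sin_le (y / 2); set s := `|sin _| => sy.
have s0 : 0 <= s by exact: normr_ge0.
have : s ^+ 2 <= `|y / 2| ^+ 2 by rewrite lerXn2r// nnegrE.
rewrite [X in _ <= X]real_normK ?num_real// expr_div_n; lra.
Qed.

(** The mean value theorem gives [sin z >= z cos 1] on [0, 1]; this is used at [|y| / 2] in the
    half-angle formula. *)
Lemma one_sub_cos_ge y : `|y| <= 1 -> cos 1 ^+ 2 / 2 * y ^+ 2 <= 1 - cos y.
Proof.
have c1 := @cos1_gt0 R.
have sin_lb (z : R) : 0 <= z -> z <= 1 -> cos 1 * z <= sin z.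
  move=> z0 z1; have [c] := @MVT_segment R sin cos 0 z z0
    (fun x _ => is_derive_sin x) (continuous_subspaceT (@continuous_sin R)).
  rewrite in_itv /= sin0 !subr0 => /andP[c0 cz] ->; rewrite ler_wpM2r//.
  have pi2 := @pi_ge2 R.
  have [->//|c1'] := eqVneq c 1.
  have := @ltr_cos R c 1; rewrite !in_itv /=.
  move=> h; apply: ltW; rewrite h; [by rewrite lt_neqAle c1' (le_trans cz)| |lra].
  by rewrite c0 (le_trans cz)// (le_trans z1)//; lra.
have even (z : R) : `|z| <= 1 -> (cos 1 : R) ^+ 2 * z ^+ 2 <= sin z ^+ 2.
  have main (u : R) : 0 <= u -> u <= 1 -> cos 1 ^+ 2 * u ^+ 2 <= sin u ^+ 2.
    move=> u0 u1; have cu0 : 0 <= cos 1 * u by exact: mulr_ge0 (ltW c1) u0.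
    have cus := sin_lb _ u0 u1.
    by rewrite -exprMn lerXn2r// nnegrE// (le_trans cu0).
  have [z0|z0] := leP 0 z; first by rewrite ger0_norm// => /main; apply.
  rewrite ltr0_norm// => z1; have := main (- z); rewrite sinN !sqrrN; apply => //.
  by rewrite oppr_ge0 ltW.
move=> y1; rewrite one_sub_cosE; have := even (y / 2).
rewrite normrM [`|2^-1|]ger0_norm; last by lra.
rewrite expr_div_n => /(_ ltac:(lra)); lra.
Qed.

(** A quadratic error, cruder than the cubic one near 0, can be integrated with a finite second
    moment alone. *)
Lemma norm_sin_sub_le y : `|sin y - y| <= y ^+ 2.
Proof.
wlog y0 : y / 0 <= y.
  move=> h; have [/h//|yN] := leP 0 y.
  have := h (- y); rewrite sinN sqrrN -opprD normrN; apply.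
  by rewrite oppr_ge0 ltW.
have cont : continuous (fun x : R => sin x - x).
  by move=> x; apply: cvgB; [exact: continuous_sin|exact: cvg_id].
have [c] := @MVT_segment R (fun x => sin x - x) (fun x => cos x - 1) 0 y y0
  (fun x _ => is_deriveB _ _) (continuous_subspaceT cont).
rewrite in_itv /= sin0 !subr0 => /andP[c0 cy] ->.
rewrite normrM (ger0_norm y0) expr2 ler_wpM2r//.
rewrite distrC ger0_norm ?subr_ge0 ?cos_le1// one_sub_cosE.
apply: le_trans cy; rewrite -(real_normK (num_real (sin (_ / 2)))).
have s1 := @sin_max R (c / 2).
have := norm_sin_le (c / 2); rewrite [`|c / 2|]ger0_norm; last by lra.
have : 0 <= `|sin (c / 2)| by [].
move: s1; set s := `|_|; nra.
Qed.

End trigonometric_bounds.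

(** * Bounds on a single characteristic function, and its decay near 0 *)

Section characteristic_function_bounds.
Context d (T : measurableType d) (R : realType) (P : probability T R).
Implicit Type X : {RV P >-> R}.

Lemma chf2_ge0 (Y : T -> R) t : 0 <= chf2 P Y t.
Proof. by rewrite addr_ge0// sqr_ge0. Qed.

Lemma integrable_cos X t : P.-integrable setT (EFin \o (fun w => cos (t * X w))).
Proof.
apply: (@integrable_bounded_comp _ _ _ _ X (fun y => cos (t * y)) 1).
  exact: measurable_cos_mul.
by move=> y; exact: cos_max.
Qed.

Lemma integrable_sin X t : P.-integrable setT (EFin \o (fun w => sin (t * X w))).
Proof.
apply: (@integrable_bounded_comp _ _ _ _ X (fun y => sin (t * y)) 1).
  exact: measurable_sin_mul.
by move=> y; exact: sin_max.
Qed.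

(* With [u] the real part and [v] the imaginary part of the characteristic
   function, [u cos + v sin <= (u^2 + v^2 + 1) / 2] pointwise, by AM-GM. *)
Lemma chf2_le1 X t : chf2 P X t <= 1.
Proof.
rewrite /chf2; set u := \int[P]_w cos _; set v := \int[P]_w sin _.
suff : u * u + v * v <= (u ^+ 2 + v ^+ 2 + 1) / 2 by rewrite -!expr2; lra.
have ic := integrable_cos X t; have hs := integrable_sin X t.
have iuc : P.-integrable setT (EFin \o (fun w => u * cos (t * X w))).
  exact: (integrableZl measurableT _ ic).
have ivs : P.-integrable setT (EFin \o (fun w => v * sin (t * X w))).
  exact: (integrableZl measurableT _ hs).
rewrite {2}/u {2}/v -!RintegralZl// -RintegralD//.
set b := _ / 2; have -> : b = \int[P]_w (cst b w).
  by rewrite Rintegral_cst//= probability_setT mulr1.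
apply: le_Rintegral => //.
- exact: (integrableD measurableT iuc ivs).
- by apply: (@integrable_bounded _ _ _ _ _ `|b|).
move=> w _ /=; rewrite /b.
have := cos2Dsin2 (t * X w); have := sqr_ge0 (u - cos (t * X w)).
have := sqr_ge0 (v - sin (t * X w)); rewrite !sqrrB; lra.
Qed.

(** The integral is [u cos b + v sin b], with [u] and [v] the real and imaginary parts;
    Cauchy-Schwarz in the plane bounds its square uniformly in [b]. *)
Lemma cos_shift_le X (t b : R) :
  `|\int[P]_w cos (t * X w - b)| ^+ 2 <= chf2 P X t.
Proof.
have -> : \int[P]_w cos (t * X w - b) =
    (\int[P]_w cos (t * X w)) * cos b + (\int[P]_w sin (t * X w)) * sin b.
  have ic := integrable_cos X t; have hs := integrable_sin X t.
  rewrite -!RintegralZr// -RintegralD//.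
  - by apply: eq_Rintegral => w _; rewrite cosB.
  - exact: (integrableZr measurableT _ ic).
  - exact: (integrableZr measurableT _ hs).
rewrite real_normK ?num_real// /chf2.
have := cos2Dsin2 b; move: (\int[P]_w cos _) (\int[P]_w sin _) (cos b) (sin b).
move=> u v c s cs; rewrite -[leRHS]mulr1 -cs.
(* The difference of the two sides is exactly this square. *)
have := sqr_ge0 (u * s - v * c); nra.
Qed.

(** If all truncated moments vanished, monotone convergence would make the second moment 0 instead
    of 1. Truncation keeps [s X] in the range where the lower bound on [1 - cos] is available. *)
Lemma truncated_second_moment_gt0 X :
  (\int[P]_w (X w ^+ 2)%:E = 1)%E ->
  exists n : nat, 0 < \int[P]_w (if `|X w| <= n%:R then X w ^+ 2 else 0).
Proof.
move=> X2.
pose g (n : nat) (w : T) : \bar R := (if `|X w| <= n%:R then X w ^+ 2 else 0)%:E.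
have mg n : measurable_fun setT (g n).
  apply/measurable_EFinP.
  have -> : (fun w => if `|X w| <= n%:R then X w ^+ 2 else 0) =
      (fun y : R => if `|y| <= n%:R then y ^+ 2 else 0) \o X by [].
  apply: measurableT_comp => //.
  apply: measurable_fun_ifT => //.
  apply: measurable_fun_ler => //.
have g0 n w : (0 <= g n w)%E.
  by rewrite /g lee_fin; case: ifP => // _; exact: sqr_ge0.
have gX n w : (g n w <= (X w ^+ 2)%:E)%E.
  by rewrite /g lee_fin; case: ifP => // _; exact: sqr_ge0.
have mX2 : measurable_fun setT (fun w => (X w ^+ 2)%:E).
  by apply/measurable_EFinP; exact: measurable_funX.
have gle n : (\int[P]_w g n w <= 1)%E.
  rewrite -X2; apply: ge0_le_integral => //.
apply: contrapT => /forallNP h.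
have gint0 n : (\int[P]_w g n w = 0)%E.
  have gfin : (\int[P]_w g n w)%E \is a fin_num.
    rewrite ge0_fin_numE; first exact: le_lt_trans (gle n) (ltry _).
    exact: integral_ge0.
  have := h n => /negP; rewrite -leNgt => hn.
  rewrite -(fineK gfin); congr EFin; apply/eqP; rewrite eq_le; apply/andP; split => //.
  by rewrite fine_ge0// integral_ge0.
have nd w : setT w -> nondecreasing_seq (g ^~ w).
  move=> _ m n mn; rewrite /g lee_fin.
  case: ifP => [xm|_]; last by case: ifP => // _; exact: sqr_ge0.
  by rewrite ifT// (le_trans xm)// ler_nat.
have := @cvg_monotone_convergence _ T R P setT measurableT g mg (fun n x _ => g0 n x) nd.
rewrite (_ : (fun n => _) = cst 0%E); last by apply/funext => n; exact: gint0.
have -> : (\int[P]_w limn (g ^~ w) = 1)%E.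
  rewrite -X2; apply: eq_integral => w _; apply/cvg_lim => //.
  apply: cvg_near_cst; near=> n; rewrite /g ifT//.
  by near: n; exact: nbhs_infty_ger.
move=> /(cvg_unique (@ereal_hausdorff R) (cvg_cst 0%E)) /eqP.
by rewrite eqe eq_sym oner_eq0.
Unshelve. all: by end_near. Qed.

(** Let [q = s^2]. Centering gives [|S| <= q] for the imaginary part, and the truncated second
    moment gives [C <= 1 - c q] for the real part. Hence [C^2 + S^2 <= (1 - c q)^2 + q^2 <= 1 - c q]
    as soon as [(c^2 + 1) q <= c]. *)
Lemma chf2_near0 X : 'E_P[X]%E = 0%E -> variance P X = 1%E ->
  exists c s0 : R, [/\ 0 < c, 0 < s0 &
    forall s, `|s| <= s0 -> chf2 P X s <= expR (- (c * s ^+ 2))].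
Proof.
move=> EX VX.
have X2 : (\int[P]_w (X w ^+ 2)%:E = 1)%E.
  rewrite -VX /variance covariance.unlock EX /= expectation.unlock.
  by apply: eq_integral => w _ /=; rewrite expr2 -[in LHS](subr0 (X w)).
have mX2 : measurable_fun setT (fun w => X w ^+ 2) by exact: measurable_funX.
have iX2 : P.-integrable setT (EFin \o (fun w => X w ^+ 2)).
  apply/integrableP; split; first exact/measurable_EFinP.
  under eq_integral => w _ do rewrite /= ger0_norm ?sqr_ge0//.
  by rewrite X2 ltry.
have i1 : P.-integrable setT (EFin \o (cst (1:R) : T -> R)).
  by apply: (@integrable_bounded _ _ _ _ _ 1) => // w; rewrite /= normr1.
have iX : P.-integrable setT (EFin \o X).
  apply: (le_integrable measurableT _ _ (integrableD measurableT i1 iX2)).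
    exact/measurable_EFinP.
  move=> w _ /=; rewrite lee_fin [leRHS]ger0_norm ?addr_ge0 ?sqr_ge0//.
  rewrite -(real_normK (num_real (X w))); move: (normr_ge0 (X w)).
  by move: `|X w| => y y0; have := sqr_ge0 (y - 1); nra.
have RX : \int[P]_w X w = 0 by move: EX; rewrite expectation.unlock /Rintegral => ->.
have RX2 : \int[P]_w (X w ^+ 2) = 1 by rewrite /Rintegral X2.
have [n] := truncated_second_moment_gt0 X2; set v := (X in 0 < X) => v0.
pose c := cos (1:R) ^+ 2 / 2 * v.
have c0 : 0 < c.
  by rewrite mulr_gt0// divr_gt0// exprn_gt0// cos1_gt0.
(* The three terms ensure [s^2 <= 1], then [|s X| <= 1] wherever [|X| <= n], and finally
   [(c^2 + 1) s^2 <= c]. *)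
pose s0 := Num.min 1 (Num.min (n%:R + 1)^-1 (c / (c ^+ 2 + 1))).
exists c, s0; split => //.
  by rewrite !lt_min ltr01 invr_gt0 ltr_wpDl//= divr_gt0// ltr_wpDl// sqr_ge0.
move=> s; rewrite !le_min => /and3P[s1 sn sc].
set C := \int[P]_w cos (s * X w); set S := \int[P]_w sin (s * X w).
have ic := integrable_cos X s; have hs := integrable_sin X s.
have isX2 : P.-integrable setT (EFin \o (fun w => s ^+ 2 * X w ^+ 2)).
  exact: (integrableZl measurableT _ iX2).
have i1c : P.-integrable setT (EFin \o (fun w => 1 - cos (s * X w))).
  exact: (integrableB measurableT i1 ic).
have C1 : \int[P]_w (1 - cos (s * X w)) = 1 - C.
  by rewrite RintegralB// Rintegral_cst//= probability_setT mulr1.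
have Slt : `|S| <= s ^+ 2.
  have isX : P.-integrable setT (EFin \o (fun w => s * X w)).
    exact: (integrableZl measurableT _ iX).
  have isB : P.-integrable setT (EFin \o (fun w => sin (s * X w) - s * X w)).
    exact: (integrableB measurableT hs isX).
  have -> : S = \int[P]_w (sin (s * X w) - s * X w).
    by rewrite RintegralB// RintegralZl// RX mulr0 subr0.
  apply: le_trans (le_normr_Rintegral measurableT isB) _.
  rewrite -[leRHS]mulr1 -RX2 -RintegralZl//.
  apply: le_Rintegral => //; first exact: (integrable_norm isB).
  by move=> w _; rewrite -exprMn norm_sin_sub_le.
(* With [s^2 <= 1] this makes [C] nonnegative, so that [C <= 1 - c s^2] may be squared below. *)
have Cge : 1 - C <= s ^+ 2 / 2.
  have -> : s ^+ 2 / 2 = \int[P]_w (s ^+ 2 / 2 * X w ^+ 2).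
    by rewrite RintegralZl// RX2 mulr1.
  rewrite -C1.
  have ih : P.-integrable setT (EFin \o (fun w => s ^+ 2 / 2 * X w ^+ 2)).
    exact: (integrableZl measurableT _ iX2).
  apply: le_Rintegral => //.
  by move=> w _; rewrite (le_trans (one_sub_cos_le _))// exprMn mulrAC.
have Cle : c * s ^+ 2 <= 1 - C.
  pose f w := if `|X w| <= n%:R then X w ^+ 2 else 0.
  have mf : measurable_fun setT f.
    have -> : f = (fun y : R => if `|y| <= n%:R then y ^+ 2 else 0) \o X by [].
    apply: measurableT_comp => //; apply: measurable_fun_ifT => //.
    exact: measurable_fun_ler.
  have if_ : P.-integrable setT (EFin \o f).
    apply: (@integrable_bounded _ _ _ _ _ (n%:R ^+ 2)) => // w; rewrite /f.
    case: ifP => [Xn|_]; last by rewrite normr0 sqr_ge0.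
    by rewrite normrX lerXn2r// nnegrE.
  rewrite -C1 /c mulrAC -RintegralZl//.
  have ih : P.-integrable setT
      (EFin \o (fun w => cos 1 ^+ 2 / 2 * s ^+ 2 * f w)).
    exact: (integrableZl measurableT _ if_).
  apply: le_Rintegral => //.
  move=> w _; rewrite /f; case: ifP => [Xn|_]; last by rewrite mulr0 subr_ge0 cos_le1.
  apply: le_trans (one_sub_cos_ge _).
    set a := cos 1 ^+ 2 / 2.
    rewrite (_ : (s * X w) ^+ 2 = s ^+ 2 * X w ^+ 2) ?(mulrA a) ?lexx//.
    ring.
  rewrite normrM; apply: le_trans (ler_pM _ _ sn Xn) _ => //.
  have n1 : 0 < n%:R + 1 :> R by rewrite ltr_wpDl.
  by rewrite mulrC ler_pdivrMr// mul1r lerDl.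
rewrite /chf2 -/C -/S; apply: le_trans (expR_ge1Dx _).
have s2 : s ^+ 2 <= 1 by rewrite -(real_normK (num_real s)) exprn_ile1.
have s2c : (c ^+ 2 + 1) * s ^+ 2 <= c.
  have c2 : 0 < c ^+ 2 + 1 by rewrite ltr_wpDl// sqr_ge0.
  rewrite mulrC -ler_pdivlMr//; apply: le_trans sc.
  by rewrite -(real_normK (num_real s)) expr2 ler_piMr.
have s20 := sqr_ge0 s.
have S2 : S ^+ 2 <= s ^+ 2 ^+ 2.
  by rewrite -(real_normK (num_real S)) lerXn2r// nnegrE.
have C2 : C ^+ 2 <= (1 - c * s ^+ 2) ^+ 2 by rewrite lerXn2r// ?nnegrE; lra.
move: s2 s2c s20 S2 C2; move: (s ^+ 2) => q; nra.
Qed.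

End characteristic_function_bounds.

Lemma cos_ge_cos1 (R : realType) (y : R) : `|y| <= 1 -> cos 1 <= cos y.
Proof.
rewrite -[cos y]cos_norm; have := normr_ge0 y; move: `|y| => z z0 z1.
have pi2 := @pi_ge2 R.
have [->//|z1'] := eqVneq z 1.
have := @ltr_cos R z 1; rewrite !in_itv /= => h; apply: ltW; rewrite h.
- by rewrite lt_neqAle z1'.
- by rewrite z0 (le_trans z1)//; lra.
- lra.
Qed.

(** * Small ball probabilities from integer frequencies *)

Section concentration.
Context d (T : measurableType d) (R : realType) (P : probability T R).

Lemma integrable_sum_ord n (f : 'I_n -> T -> R) :
  (forall i, P.-integrable setT (EFin \o f i)) ->
  P.-integrable setT (EFin \o (fun w => \sum_(i < n) f i w)).
Proof.
elim: n f => [|n IH] f fi.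
  have -> : (fun w => \sum_(i < 0) f i w) = cst 0.
    by apply/funext => w; rewrite big_ord0.
  by apply: (@integrable_bounded _ _ _ _ _ 0) => // w; rewrite /= normr0.
have -> : (fun w => \sum_(i < n.+1) f i w) =
    (fun w => \sum_(i < n) f (widen_ord (leqnSn n) i) w + f ord_max w).
  by apply/funext => w; rewrite big_ord_recr.
exact: (integrableD measurableT (IH _ (fun i => fi (widen_ord (leqnSn n) i))) (fi _)).
Qed.

Lemma Rintegral_sum_ord n (f : 'I_n -> T -> R) :
  (forall i, P.-integrable setT (EFin \o f i)) ->
  \int[P]_w (\sum_(i < n) f i w) = \sum_(i < n) \int[P]_w f i w.
Proof.
elim: n f => [|n IH] f fi.
  rewrite big_ord0; under eq_Rintegral do rewrite big_ord0.
  by rewrite Rintegral_cst// mul0r.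
under eq_Rintegral do rewrite big_ord_recr/=.
rewrite big_ord_recr/= RintegralD// ?IH//.
exact: (integrable_sum_ord (fun i => fi (widen_ord (leqnSn n) i))).
Qed.

Lemma measurable_norm_sub_lt (X : {RV P >-> R}) (a delta : R) :
  measurable [set w | `|X w - a| < delta].
Proof.
have mf : measurable_fun setT (fun w => `|X w - a|).
  apply: (@measurableT_comp _ _ _ _ _ _ (fun y : R => `|y|)) => //.
  exact: measurable_funB.
rewrite (_ : [set w | _] = (fun w => `|X w - a|) @^-1` `]-oo, delta[%classic).
  by rewrite -[X in measurable X]setTI; exact: mf.
by apply/seteqP; split => w /=; rewrite in_itv.
Qed.

(* The squared modulus of [sum_(j < M) exp(i j th)] is nonnegative, and at least
   [(M cos 1)^2] when [M |th| <= 1]; unlike the Fourier transform of a bump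
   function it only involves finitely many frequencies. The truncated
   differences [(j - k) + (k - j)] encode [|j - k|]. *)
Lemma concentration_le (X : {RV P >-> R}) (a delta : R) (M : nat) (g : nat -> R) :
  M%:R * delta <= 1 ->
  (forall m b, (m < M)%N -> `|\int[P]_w cos (m%:R * X w - b)| <= g m) ->
  fine (P [set w | `|X w - a| < delta]) * (M%:R * cos 1) ^+ 2 <=
    \sum_(j < M) \sum_(k < M) g ((j - k) + (k - j))%N.
Proof.
move=> Mdelta hg; set A := [set w | _].
pose D (j k : 'I_M) := ((j - k) + (k - j))%N.
have DM j k : (D j k < M)%N.
  have /= := ltn_ord j; have /= := ltn_ord k; rewrite /D.
  have [jk|/ltnW jk] := leqP j k.
    by move=> kM _; rewrite (eqP jk) add0n (leq_ltn_trans (leq_subr _ _)).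
  by move=> _ jM; rewrite (eqP jk) addn0 (leq_ltn_trans (leq_subr _ _)).
pose F w := \sum_(j < M) \sum_(k < M) cos ((D j k)%:R * X w - (D j k)%:R * a).
have icos j k : P.-integrable setT
    (EFin \o (fun w => cos ((D j k)%:R * X w - (D j k)%:R * a))).
  apply: (@integrable_bounded_comp _ _ _ _ X
    (fun y => cos ((D j k)%:R * y - (D j k)%:R * a)) 1) => [|y]; last exact: cos_max.
  apply: (@measurableT_comp _ _ _ _ _ _ cos).
    by apply: continuous_measurable_fun; exact: continuous_cos.
  by apply: measurable_funB => //; exact: measurable_funM.
have iF : P.-integrable setT (EFin \o F).
  by apply: integrable_sum_ord => j; exact: integrable_sum_ord.
have FE w : F w = (\sum_(j < M) cos (j%:R * (X w - a))) ^+ 2 +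
    (\sum_(j < M) sin (j%:R * (X w - a))) ^+ 2.
  rewrite !expr2 !big_distrlr -big_split /=; apply: eq_bigr => j _.
  rewrite -big_split /=; apply: eq_bigr => k _.
  rewrite -cosB -!mulrBl -mulrBr /D.
  have [jk|/ltnW jk] := leqP j k.
    by rewrite (eqP jk) add0n natrB// -cosN -mulNr opprB.
  by rewrite (eqP jk) addn0 natrB.
have mA : measurable A by exact: measurable_norm_sub_lt.
have PA : fine (P A) = \int[P]_w (\1_A w).
  by rewrite /Rintegral integral_indic// setIT.
have iA : P.-integrable setT (EFin \o (\1_A : T -> R)).
  apply: (@integrable_bounded _ _ _ _ _ 1) => [|w].
    exact: measurable_indic.
  by rewrite indicE; case: (_ \in _); rewrite ?normr1 ?normr0.
rewrite mulrC PA -RintegralZl//.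
apply: (@le_trans _ _ (\int[P]_w F w)).
  apply: le_Rintegral => //.
    exact: (integrableZl measurableT _ iA).
  (* Off [A] a sum of two squares is compared with 0. On [A] every angle [j (X - a)] has absolute
     value at most 1, because [M delta <= 1]. *)
  move=> w _; rewrite FE indicE; have [wA|_] := boolP (w \in A); last first.
    by rewrite mulr0 addr_ge0// sqr_ge0.
  rewrite mulr1; move: wA; rewrite inE /A /= => wA.
  apply: ler_wpDr; first exact: sqr_ge0.
  have Mc : M%:R * cos 1 = \sum_(j < M) cos 1 :> R.
    by rewrite sumr_const card_ord mulr_natl.
  have c1 := @cos1_gt0 R.
  have le1 : M%:R * cos 1 <= \sum_(j < M) cos (j%:R * (X w - a)).
    rewrite Mc; apply: ler_sum => j _; apply: cos_ge_cos1.
    rewrite normrM normr_nat; apply: le_trans Mdelta.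
    by apply: ler_pM => //; [rewrite ler_nat ltnW|exact: ltW].
  have M0 : 0 <= M%:R * cos 1 :> R by rewrite mulr_ge0// ltW.
  by rewrite lerXn2r// nnegrE// (le_trans M0).
rewrite /F Rintegral_sum_ord; last by move=> j; exact: integrable_sum_ord.
apply: ler_sum => j _; rewrite Rintegral_sum_ord//; apply: ler_sum => k _.
exact: le_trans (ler_norm _) (hg _ _ (DM j k)).
Qed.

(** In the product of characteristic functions, factors with argument at most [s0] get the Gaussian
    bound and the others the trivial bound 1. *)
Lemma chf2_wsum_le (c : nat -> R) (X : nat -> {RV P >-> R}) k t (c0 s0 : R) :
  iid X -> (forall s, `|s| <= s0 -> chf2 P (X 0%N) s <= expR (- (c0 * s ^+ 2))) ->
  chf2 P (wsum c X k) t <=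
    expR (- (c0 * \sum_(i < k | `|t * c i| <= s0) (t * c i) ^+ 2)).
Proof.
move=> Xiid near0; rewrite chf2_wsum// [X in c0 * X]big_mkcond mulr_sumr -sumrN expR_sum.
apply: ler_prod => i _; rewrite chf2_ge0 /=.
by case: ifP => [/near0//|_]; rewrite mulr0 oppr0 expR0 chf2_le1.
Qed.

End concentration.

(** * Geometric sums in the distance to a fixed index *)

Section geometric_sum.
Variables (R : realType) (r : R).
Hypothesis r01 : 0 <= r <= 1.

(** Multiplying by [1 - r] makes the sum telescope on each side of [j], each side giving at most 1.
    As the bound does not depend on [M], the double sum over [j] and [k] is linear in [M]. *)
Lemma two_sided_geometric_sum (j M : nat) :
  (1 - r) * \sum_(k < M) r ^+ ((j - k) + (k - j)) <= 2.
Proof.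
have [r0 r1] := andP r01.
have lo m : (m <= j.+1)%N ->
    (1 - r) * \sum_(k < m) r ^+ ((j - k) + (k - j)) <= r ^+ (j.+1 - m).
  elim: m => [_|m IH mj]; first by rewrite big_ord0 mulr0 exprn_ge0.
  have mj' : (m <= j)%N by [].
  rewrite big_ord_recr/= mulrDr; have := IH (ltnW mj).
  by rewrite (eqP mj') addn0 subSS subSn// exprS; lra.
have hi m : (1 - r) * \sum_(k < j.+1 + m) r ^+ ((j - k) + (k - j)) <= 2 - r ^+ m.+1.
  elim: m => [|m IH].
    have := lo j.+1 (leqnn _); rewrite addn0 subnn expr0 expr1; lra.
  rewrite addnS big_ord_recr/= mulrDr; move: IH.
  rewrite (_ : (j - (j.+1 + m) + (j.+1 + m - j))%N = m.+1); last first.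
    by rewrite addSnnS addKn (eqP (leq_addr _ _)).
  by rewrite !exprS; lra.
have [Mj|/ltnW jM] := leqP M j.+1.
  by apply: le_trans (lo _ Mj) _; rewrite (le_trans (exprn_ile1 _ _ _))//; lra.
by rewrite -(subnKC jM); apply: le_trans (hi _) _; rewrite lerBlDr lerDl exprn_ge0.
Qed.

End geometric_sum.

(** * Poisson weights: mass, decay in the right tail, slow variation *)

Section poisson_weights.
Variable R : realType.
Implicit Types (lam h tau : R) (i j n : nat).

Definition pois lam i : R := expR (- lam) * lam ^+ i / i`!%:R.

Lemma pois_ge0 lam i : 0 <= lam -> 0 <= pois lam i.
Proof. by move=> l0; rewrite !mulr_ge0 ?expR_ge0 ?exprn_ge0// invr_ge0. Qed.

Lemma pois_le1 lam i : 0 <= lam -> pois lam i <= 1.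
Proof.
move=> l0; rewrite /pois expRN -mulrA ler_pdivrMl ?expR_gt0// mulr1.
case: i => [|i]; last by apply: le_trans (expR_ge1Dxn i l0); rewrite lerDr.
by rewrite expr0 fact0 divr1; apply: le_trans (expR_ge1Dx _); rewrite lerDl.
Qed.

Lemma poisS lam i : i.+1%:R * pois lam i.+1 = lam * pois lam i.
Proof.
rewrite /pois exprS factS natrM invfM.
have i0 : i.+1%:R != 0 :> R by rewrite pnatr_eq0.
have f0 : i`!%:R != 0 :> R by rewrite pnatr_eq0 -lt0n fact_gt0.
move: (i.+1%:R) (i`!%:R) (lam ^+ i) (expR _) i0 f0 => a b p e a0 b0.
by field; rewrite ?a0 ?b0.
Qed.

(* Summing [(i - lam) pois i = lam (pois (i - 1) - pois i)] telescopes. *)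
Lemma pois_partial_sum_le lam n j : 0 <= lam -> lam <= n%:R ->
  \sum_(i < n.+1 + j) pois lam i <=
    \sum_(i < n.+1) pois lam i + lam * (pois lam n - pois lam (n + j)).
Proof.
move=> l0 ln; elim: j => [|j IH]; first by rewrite !addn0 subrr mulr0 addr0.
rewrite addnS big_ord_recr/= addnS.
have := poisS lam (n + j); rewrite addSn -natr1 natrD mulrDl mul1r.
have p0 := pois_ge0 (n + j).+1 l0.
have : lam * pois lam (n + j).+1 <= (n%:R + j%:R) * pois lam (n + j).+1.
  by rewrite ler_wpM2r// ler_wpDr.
by move: IH; lra.
Qed.

(** The total mass is 1; letting the upper end of the telescoped bound tend to infinity leaves a
    tail of at most [lam * pois lam n]. *)
Lemma pois_mass lam n : 0 <= lam -> lam <= n%:R ->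
  1 - lam * pois lam n <= \sum_(i < n.+1) pois lam i.
Proof.
move=> l0 ln; rewrite lerBlDr.
have cvg : series (fun i => pois lam i) @ \oo --> (1 : R).
  have -> : series (fun i => pois lam i) =
      (fun k => expR (- lam) * series (exp_coeff lam) k).
    apply/funext => k; rewrite /series /= mulr_sumr.
    by apply: eq_bigr => i _; rewrite /pois /exp_coeff mulrA.
  rewrite -(expRxMexpNx_1 lam) mulrC; apply: cvgMr.
  exact: is_cvg_series_exp_coeff.
rewrite -(cvg_lim (@Rhausdorff R) cvg).
apply: limr_le; first by apply/cvg_ex; exists 1.
near=> k; have nk : (n.+1 <= k)%N by near: k; exact: nbhs_infty_ge.
rewrite /series /= big_mkord -(subnKC nk).
apply: le_trans (pois_partial_sum_le _ l0 ln) _.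
by rewrite lerD2l ler_wpM2l// lerBlDr lerDl pois_ge0.
Unshelve. all: by end_near. Qed.

(** Beyond [lam + h] the ratio of consecutive weights is at most [lam / (lam + h)], which is at most
    [e^(-h / (2 lam))] because [h <= lam]. *)
Lemma pois_decay lam h i j : 0 < lam -> 0 <= h -> h <= lam -> lam + h <= i%:R ->
  pois lam (i + j) <= expR (- (j%:R * (h / (2 * lam)))).
Proof.
move=> l0 h0 hl lhi; elim: j => [|j IH].
  by rewrite addn0 mul0r oppr0 expR0 pois_le1// ltW.
have pS := poisS lam (i + j).
have lh : lam + h <= (i + j).+1%:R by rewrite (le_trans lhi)// ler_nat -addnS leq_addr.
rewrite addnS -natr1 mulrDl opprD expRD mul1r.
have e0 := expR_gt0 (- (h / (2 * lam))).
have eh : lam <= (lam + h) * expR (- (h / (2 * lam))).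
  apply: (@le_trans _ _ ((lam + h) * (1 - h / (2 * lam)))).
    have -> : (lam + h) * (1 - h / (2 * lam)) = lam + h / 2 - h * (h / lam) / 2.
      by field; rewrite gt_eqF.
    have : h / lam <= 1 by rewrite ler_pdivrMr// mul1r.
    by move: (h / lam) => u u1; nra.
  by rewrite ler_wpM2l ?expR_ge1Dx// addr_ge0// ltW.
have lh0 : 0 < lam + h by rewrite ltr_wpDr.
rewrite -(ler_pM2l lh0); apply: (@le_trans _ _ (lam * pois lam (i + j))).
  by rewrite -pS; apply: ler_wpM2r => //; exact/pois_ge0/ltW.
rewrite (mulrC (expR _) (expR (- (h / _)))) (mulrA (lam + h)).
by apply: ler_pM => //; rewrite ?pois_ge0// ltW.
Qed.

(** Each of the [L] steps multiplies the weight by [lam] over an index at most [K]. *)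
Lemma pois_slow lam K i L tau : 0 < lam -> 0 <= tau ->
  (i + L <= K)%N -> lam <= K%:R -> tau <= pois lam i ->
  tau * (lam / K%:R) ^+ L <= pois lam (i + L).
Proof.
move=> l0 t0; elim: L => [|L IH] iLK lK ti; first by rewrite expr0 mulr1 addn0.
have K0 : 0 < K%:R :> R by exact: lt_le_trans l0 lK.
have := IH (ltnW _) lK ti; rewrite -addnS => /(_ iLK) IH'.
have pS := poisS lam (i + L); rewrite -addnS in pS.
rewrite exprS mulrCA mulrAC ler_pdivrMr//.
apply: (@le_trans _ _ (lam * pois lam (i + L))).
  by rewrite ler_pM2l.
by rewrite -pS mulrC ler_wpM2l ?ler_nat// pois_ge0// ltW.
Qed.

Lemma bernoulli_half (u : R) L : 0 <= u -> u <= 1 -> L%:R * u <= 1 / 2 ->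
  1 / 2 <= (1 - u) ^+ L.
Proof.
move=> u0 u1 Lu; suff : 1 - L%:R * u <= (1 - u) ^+ L by lra.
elim: L {Lu} => [|L IH]; first by rewrite mul0r expr0 subr0.
have : (1 - L%:R * u) * (1 - u) <= (1 - u) ^+ L * (1 - u).
  by apply: ler_wpM2r => //; rewrite subr_ge0.
rewrite exprSr -natr1; have : 0 <= L%:R :> R by []. nra.
Qed.

(* Going down from an index [K] deep in the right tail, the weights cross the
   level [tau] in steps of ratio at least [lam / K], hence at least [L] of them
   lie in [[tau / 2, tau]]. *)
Lemma pois_band lam K L tau i0 : 0 < lam -> 0 < tau -> lam <= K%:R ->
  L%:R * (1 - lam / K%:R) <= 1 / 2 -> pois lam K < tau / 2 ->
  (i0 <= K)%N -> tau < pois lam i0 ->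
  L%:R * (tau / 2) <= \sum_(1 <= i < K.+1 | pois lam i <= tau) pois lam i.
Proof.
move=> l0 t0 lK LK pK i0K ti0.
(* [j] is the last index up to [K] with weight above the level; everything after it up to [K] passes
   the filter. *)
have [j [jK tj jmax]] : exists j, [/\ (j <= K)%N, tau < pois lam j &
    forall i, (j < i <= K)%N -> pois lam i <= tau].
  pose Q j := (j <= K)%N && (tau < pois lam j).
  have [] := @ex_maxnP Q K; first by exists i0; rewrite /Q i0K.
    by move=> j /andP[].
  move=> j /andP[jK tj] jmax; exists j; split => // i /andP[ji iK].
  rewrite leNgt; apply/negP => ti; have := jmax i; rewrite /Q iK ti => /(_ isT).
  by rewrite leqNgt ji.
have K0 : 0 < K%:R :> R by exact: lt_le_trans l0 lK.
have u0 : 0 <= 1 - lam / K%:R by rewrite subr_ge0 ler_pdivrMr// mul1r.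
have u1 : 1 - lam / K%:R <= 1 by rewrite gerBl divr_ge0// ltW.
have slow l : (l <= L)%N -> (j + l <= K)%N -> tau / 2 <= pois lam (j + l).
  move=> lL jlK.
  apply: le_trans (pois_slow l0 (ltW t0) jlK lK (ltW tj)).
  rewrite ler_pM2l// -[lam / _](subKr 1).
  rewrite -[X in X <= _]div1r; apply: bernoulli_half => //.
  by apply: le_trans LK; rewrite ler_wpM2r// ler_nat.
(* Otherwise [K] would be within [L] steps of [j], and its weight would be at least [tau / 2]. *)
have jL : (j + L <= K)%N.
  rewrite leqNgt; apply/negP => KjL.
  have := slow (K - j)%N; rewrite subnKC// leqnn leq_subLR (ltnW KjL) => /(_ isT isT).
  by rewrite leNgt pK.
have jKS : (j.+1 + L <= K.+1)%N by rewrite addSn ltnS.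
rewrite (big_cat_nat (n := j.+1) (p := K.+1))//=.
rewrite (big_cat_nat (n := (j.+1 + L)%N) (m := j.+1) (p := K.+1)) ?leq_addr//=.
have nn (s : seq nat) : 0 <= \sum_(i <- s | pois lam i <= tau) pois lam i.
  by apply: sumr_ge0 => i _; exact/pois_ge0/ltW.
rewrite addrCA ler_wpDr ?addr_ge0//.
rewrite big_nat_cond (eq_bigl (fun i => (j.+1 <= i < j.+1 + L)%N)) -?big_nat; last first.
  move=> i; case: (boolP (_ <= i < _)%N) => //= /andP[ji]; rewrite addSn ltnS => ijL.
  by rewrite jmax// ji (leq_trans ijL).
have -> : L%:R * (tau / 2) = \sum_(j.+1 <= i < j.+1 + L) tau / 2.
  by rewrite sumr_const_nat addKn mulr_natl.
apply: ler_sum_nat => i; rewrite addSn ltnS => /andP[ji ijL].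
by rewrite -(subnKC (ltnW ji)) slow ?subnKC ?(ltnW ji)// ?leq_subLR// (leq_trans ijL).
Qed.

End poisson_weights.

(** * Growth comparisons for large [N] *)

Section asymptotics.
Variable R : realType.
Implicit Types (A B C D N : R).

Lemma powR_dominates A B D : A < B ->
  exists2 N0, 1 <= N0 & forall N, N0 <= N -> D * N `^ A <= N `^ B.
Proof.
move=> AB; have BA : 0 < B - A by rewrite subr_gt0.
pose D1 := Num.max D 1; have D11 : 1 <= D1 by rewrite le_max lexx orbT.
have N01 : 1 <= D1 `^ (B - A)^-1.
  by rewrite -[leLHS](powRr0 D1) ler_powR// invr_ge0 ltW.
exists (D1 `^ (B - A)^-1) => // N N0N.
have N0 : 0 < N by exact: lt_le_trans (lt_le_trans ltr01 N01) N0N.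
have -> : N `^ B = N `^ (B - A) * N `^ A.
  by rewrite -powRD ?subrK//; apply/implyP => _; exact: lt0r_neq0.
rewrite ler_wpM2r ?powR_ge0//; apply: (@le_trans _ _ D1); first by rewrite le_max lexx.
have -> : D1 = (D1 `^ (B - A)^-1) `^ (B - A).
  by rewrite -powRrM mulVf ?gt_eqF// powRr1// (le_trans ler01).
by apply: ge0_ler_powR; rewrite ?nnegrE ?powR_ge0 ?(ltW BA) ?(ltW N0).
Qed.

(** One term [u^n / n!] of the exponential series, with [n] such that [e n > A], reduces the claim
    to a comparison of powers. *)
Lemma expR_dominates A D (e k : R) : 0 < e -> 0 < k ->
  exists2 N0, 1 <= N0 & forall N, N0 <= N -> D * N `^ A <= expR (k * N `^ e).
Proof.
move=> e0 k0; pose n := (Num.truncn (`|A| / e)).+1.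
have An : A < e * n%:R.
  rewrite mulrC -ltr_pdivrMr//; apply: le_lt_trans (truncnS_gt _).
  by rewrite ler_pM2r ?invr_gt0// ler_norm.
have [N0 N01 hN0] := powR_dominates (D * n`!%:R / k ^+ n) An.
exists N0 => // N N0N; have u0 : 0 <= k * N `^ e by rewrite mulr_ge0 ?powR_ge0// ltW.
apply: le_trans (expR_ge1Dxn (Num.truncn (`|A| / e)) u0).
apply: (@le_trans _ _ ((k * N `^ e) ^+ n / n`!%:R)); last by rewrite lerDr.
have f0 : 0 < n`!%:R :> R by rewrite ltr0n fact_gt0.
rewrite ler_pdivlMr// exprMn -(powR_mulrn n (powR_ge0 N e)) -powRrM.
have := hN0 N N0N; rewrite mulrAC ler_pdivrMr ?exprn_gt0//.
by rewrite [X in X <= _ -> _]mulrAC [X in _ <= X -> _]mulrC.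
Qed.

Lemma ln_le_powR N : 1 <= N -> ln N <= 4 * N `^ (1 / 4).
Proof.
move=> N1; have N0 : 0 < N by exact: lt_le_trans ltr01 N1.
have := ln_sublinear (powR_gt0 (1 / 4) N0); rewrite ln_powR; lra.
Qed.

End asymptotics.

(** * Energy carried by the Poisson weights below a level *)

Section poisson_energy.
Variable R : realType.
Implicit Types (x y s : R) (n m : nat).

(** With [lam = x^2] and [h = x y], take for [K] the integer part of [lam + 2 h], which is at most
    [(x + y)^2]. Past [lam + h] there remain at least [h - 2 >= h / 2] steps of decay rate
    [h / (2 lam)], whence the exponent [y^2 / 4]. *)
Lemma pois_tail_index x y n : 4 <= x -> 1 <= y -> y <= x ->
  x + y <= Num.sqrt n%:R ->
  exists K : nat, [/\ (K <= n)%N, x ^+ 2 <= K%:R, K%:R <= x ^+ 2 + 2 * (x * y) &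
    pois (x ^+ 2) K <= expR (- (1 / 4 * y ^+ 2))].
Proof.
move=> x4 y1 yx sn.
have h4 : 4 <= x * y by nra.
have h0 : 0 <= x * y by lra.
have hlam : x * y <= x ^+ 2 by rewrite expr2 ler_wpM2l//; lra.
have e : 1 / 4 * y ^+ 2 = (x * y) / 2 * (x * y / (2 * x ^+ 2)).
  by field; rewrite gt_eqF//; lra.
have xyn : x ^+ 2 + 2 * (x * y) <= n%:R.
  rewrite -(sqr_sqrtr (ler0n R n)); apply: (@le_trans _ _ ((x + y) ^+ 2)).
    by rewrite sqrrD -mulr_natl; have := sqr_ge0 y; lra.
  by rewrite lerXn2r// nnegrE//; lra.
move: h4 h0 hlam e xyn; move: (x * y) (x ^+ 2) => h lam {yx sn x4} h4 h0 hlam e xyn.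
have lam0 : 0 < lam by lra.
pose K := Num.truncn (lam + 2 * h); pose k1 := (Num.truncn (lam + h)).+1.
have KR : K%:R <= lam + 2 * h by rewrite truncn_le//; lra.
have KS : lam + 2 * h < K%:R + 1 by rewrite natr1 truncnS_gt.
have k1R : k1%:R <= lam + h + 1 by rewrite -natr1 lerD2r truncn_le//; lra.
have k1S : lam + h <= k1%:R by rewrite ltW// truncnS_gt.
have k1K : (k1 <= K)%N by rewrite -(ler_nat R); lra.
exists K; split => //; [by rewrite -(ler_nat R) (le_trans KR)|lra|].
rewrite -(subnKC k1K); apply: le_trans (pois_decay _ lam0 h0 hlam k1S) _.
rewrite ler_expR lerN2 natrB// e; apply: ler_wpM2r; last by lra.
by rewrite divr_ge0// mulr_ge0// ltW.
Qed.

Lemma le_inv_expR (a b u : R) : 0 < a -> a * b <= expR u -> b * expR (- u) <= a^-1.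
Proof.
by move=> a0 ab; rewrite expRN ler_pdivrMr ?expR_gt0// ler_pdivlMl.
Qed.

(** The relative loss per step [1 - x^2 / K] is at most [2 y / x], and the length [x / (4 y)] keeps
    the total loss below one half. *)
Lemma band_length x y (K : nat) : 0 < x -> 0 < y ->
  x ^+ 2 <= K%:R -> K%:R <= x ^+ 2 + 2 * (x * y) ->
  (Num.truncn (x / (4 * y)))%:R * (1 - x ^+ 2 / K%:R) <= 1 / 2.
Proof.
move=> x0 y0 lamK KR.
have lam0 : 0 < x ^+ 2 by rewrite exprn_gt0.
have K0 : 0 < K%:R :> R by exact: lt_le_trans lamK.
have h0 : 0 <= 2 * (x * y) by rewrite !mulr_ge0// ltW.
have LR : (Num.truncn (x / (4 * y)))%:R <= x / (4 * y).
  by rewrite truncn_le// divr_ge0 ?mulr_ge0// ltW.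
have u0 : 0 <= 1 - x ^+ 2 / K%:R by rewrite subr_ge0 ler_pdivrMr// mul1r.
have uK : 1 - x ^+ 2 / K%:R <= 2 * (x * y) / x ^+ 2.
  have -> : 1 - x ^+ 2 / K%:R = (K%:R - x ^+ 2) / K%:R.
    by rewrite mulrBl divff// gt_eqF.
  apply: ler_pM => //; rewrite ?subr_ge0 ?invr_ge0//; first by rewrite lerBlDl.
  by rewrite lef_pV2.
apply: le_trans (ler_pM _ u0 LR uK) _ => //.
rewrite le_eqVlt; apply/orP; left; apply/eqP; field.
by rewrite !gt_eqF.
Qed.

(** The two exponential hypotheses make the weight at the tail index [K] so small that the mass
    beyond [K] is at most 1/4 and that this weight is below half the level [(s0 / m)^2]. *)
Lemma pois_energy x y (s0 : R) n m : 4 <= x -> 1 <= y -> y <= x ->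
  x + y <= Num.sqrt n%:R -> 0 < s0 -> (0 < m)%N ->
  4 * x ^+ 2 <= expR (1 / 4 * y ^+ 2) ->
  4 / s0 ^+ 2 * m%:R ^+ 2 <= expR (1 / 4 * y ^+ 2) ->
  let W := \sum_(1 <= i < n.+1 | pois (x ^+ 2) i <= (s0 / m%:R) ^+ 2)
             pois (x ^+ 2) i in
  1 / 2 <= W \/ (Num.truncn (x / (4 * y)))%:R * (s0 ^+ 2 / 2) <= m%:R ^+ 2 * W.
Proof.
move=> x4 y1 yx sn s00 m0 E1 E2 W.
have x0 : 0 < x by lra.
have y0 : 0 < y by lra.
have [K [Kn lamK KR pK]] := pois_tail_index x4 y1 yx sn.
have LK := band_length x0 y0 lamK KR.
have lam16 : 16 <= x ^+ 2 by rewrite expr2; nra.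
move: LK lamK {KR} pK E1 @W lam16; set lam := x ^+ 2; set L := Num.truncn _.
move: lam L {x4 y1 yx sn x0 y0} => lam L LK lamK pK E1 W lam16.
have lam0 : 0 < lam by lra.
have mR0 : 0 < m%:R :> R by rewrite ltr0n.
have s2 : 0 < s0 ^+ 2 by rewrite exprn_gt0.
have lamK4 : lam * pois lam K <= 4^-1.
  apply: (le_trans _ (le_inv_expR _ E1)) => //.
  by rewrite ler_pM2l.
set tau := (s0 / m%:R) ^+ 2 in W *.
have tau0 : 0 < tau by rewrite exprn_gt0// divr_gt0.
have pKtau : pois lam K < tau / 2.
  have tE : 4 / tau * 1 <= expR (1 / 4 * y ^+ 2).
    by rewrite mulr1 /tau expr_div_n invf_div mulrA mulrAC.
  have t4 : 0 < 4 / tau by rewrite divr_gt0.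
  have := le_inv_expR t4 tE; rewrite (mul1r (expR _)) invf_div.
  by move: pK tau0; clear; lra.
have WK : \sum_(1 <= i < K.+1 | pois lam i <= tau) pois lam i <= W.
  rewrite /W (big_cat_nat (n := K.+1) (p := n.+1))//= lerDl.
  by apply: sumr_ge0 => i _; exact/pois_ge0/ltW.
(* If a positive index up to [K] exceeds the level, the weights cross it and the band lemma applies;
   otherwise all the indices from 1 to [K] are kept. *)
have [/existsP|small] := boolP [exists i : 'I_K.+1, (0 < i)%N && (tau < pois lam i)].
  move=> [i /andP[i0 ti]]; right.
  have band := pois_band lam0 tau0 lamK LK pKtau (ltn_ord i) ti.
  have -> : L%:R * (s0 ^+ 2 / 2) = m%:R ^+ 2 * (L%:R * (tau / 2)).
    by rewrite /tau; field; rewrite gt_eqF.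
  by rewrite ler_pM2l ?exprn_gt0// (le_trans band).
left; apply: le_trans WK.
have -> : \sum_(1 <= i < K.+1 | pois lam i <= tau) pois lam i =
    \sum_(1 <= i < K.+1) pois lam i.
  rewrite big_nat_cond [RHS]big_nat_cond; apply: eq_bigl => i; rewrite andbT.
  case: (boolP (_ <= i < _)%N) => //= /andP[i1 iK]; rewrite leNgt; apply/negP => ti.
  move: small; rewrite negb_exists => /forallP/(_ (Ordinal iK)) /=.
  by rewrite i1 ti.
have := pois_mass (ltW lam0) lamK.
rewrite -(big_mkord xpredT (fun i => pois lam i)) big_ltn//.
(* The sum starts at 1: the missing weight [e^(-lam)] costs a second 1/4, which leaves the mass
   1/2. *)
have : pois lam 0 <= 4^-1.
  rewrite /pois expr0 fact0 divr1 -[expR _]mul1r mulr1; apply: le_inv_expR => //.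
  by rewrite mulr1; apply: le_trans (expR_ge1Dx _); lra.
move: lamK4; clear; lra.
Qed.

(** For [y = N^eps] the band has length of order at least [N^(1 - eps)], hence at least [N^(1/2)]
    since [eps < 1/2], and this beats any multiple of [ln N]. *)
Lemma eventually_pois_energy (C eps a1 a2 s0 B : R) :
  0 < eps -> eps < 1 / 2 -> 0 < a1 -> 0 < s0 -> 0 <= B ->
  exists2 N0 : R, 1 <= N0 & forall (N : R) (n m : nat) (x : R),
    N0 <= N -> a1 * N <= x -> x <= a2 * N -> x <= Num.sqrt n%:R - N `^ eps ->
    (0 < m)%N -> m%:R <= N `^ C ->
    let W := \sum_(1 <= i < n.+1 | pois (x ^+ 2) i <= (s0 / m%:R) ^+ 2)
               pois (x ^+ 2) i in
    1 / 2 <= W \/ B * ln N <= m%:R ^+ 2 * W.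
Proof.
move=> eps0 eps2 a10 s00 B0.
(* [M1] serves for [y <= x], [M2] and [M3] for the two exponential hypotheses, and [M4] for the
   comparison of the band length with [ln N]. *)
have [|M1 M11 hM1] := @powR_dominates R eps 1 a1^-1; first by lra.
have e2 : 0 < eps * 2 by lra.
have q0 : (0 : R) < 1 / 4 by lra.
have [M2 M21 hM2] := @expR_dominates R 2 (4 * a2 ^+ 2) (eps * 2) (1 / 4) e2 q0.
have [M3 M31 hM3] := @expR_dominates R (C * 2) (4 / s0 ^+ 2) (eps * 2) (1 / 4) e2 q0.
(* The inner 4 comes from [ln N <= 4 N^(1/4)], the added 1 absorbs the rounding of the band length,
   and [4 / a1] comes from [x >= a1 N]. *)
have [|M4 M41 hM4] := @powR_dominates R (1 / 4) (1 / 2)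
   ((2 * B / s0 ^+ 2 * 4 + 1) * (4 / a1)); first by lra.
exists (Num.max (4 / a1) (Num.max M1 (Num.max M2 (Num.max M3 M4)))).
  by rewrite !le_max M11 !orbT.
move=> N n m x; rewrite !ge_max.
move=> /and5P[N0N /hM1{}hM1 /[dup] M2N /hM2{}hM2 /hM3{}hM3 /hM4{}hM4].
move=> a1x xa2 xn m0 mC W.
have Nge1 : 1 <= N by exact: le_trans M21 M2N.
have Np : 0 < N by exact: lt_le_trans ltr01 Nge1.
rewrite powRr1 ?(ltW Np)// in hM1.
have y1 : 1 <= N `^ eps by rewrite -[leLHS](powRr0 N) ler_powR// ltW.
have xy : a1 / 4 * N `^ (1 / 2) <= x / (4 * N `^ eps).
  rewrite ler_pdivlMr ?mulr_gt0 ?powR_gt0//.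
  have Ny : N `^ (1 / 2) * N `^ eps <= N.
    rewrite -powRD; last by apply/implyP => _; exact: lt0r_neq0.
    by rewrite -[leRHS](powRr1 (ltW Np)) ler_powR//; lra.
  apply: le_trans a1x; rewrite -(ler_pM2l a10) in Ny.
  by move: Ny; clear; lra.
rewrite !powRrM !powR_mulrn ?powR_ge0 ?(ltW Np)// in hM2 hM3.
have yx : N `^ eps <= x by apply: le_trans a1x; rewrite mulrC -ler_pdivrMr// mulrC.
have x4 : 4 <= x by apply: le_trans a1x; rewrite mulrC -ler_pdivrMr.
have x0 : 0 <= x by lra.
have sn : x + N `^ eps <= Num.sqrt n%:R by rewrite -lerBrDr.
have E1 : 4 * x ^+ 2 <= expR (1 / 4 * (N `^ eps) ^+ 2).
  apply: le_trans hM2; rewrite -mulrA ler_pM2l// -exprMn lerXn2r// nnegrE//.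
  exact: le_trans x0 xa2.
have E2 : 4 / s0 ^+ 2 * m%:R ^+ 2 <= expR (1 / 4 * (N `^ eps) ^+ 2).
  apply: le_trans hM3; rewrite ler_pM2l ?divr_gt0 ?exprn_gt0//.
  by rewrite lerXn2r// ?nnegrE ?powR_ge0.
have [|LW] := pois_energy x4 y1 yx sn s00 m0 E1 E2; [by left|right].
apply: le_trans LW.
have LS : x / (4 * N `^ eps) < (Num.truncn (x / (4 * N `^ eps)))%:R + 1.
  by rewrite natr1 truncnS_gt.
have s2 : 0 < s0 ^+ 2 / 2 by rewrite divr_gt0// exprn_gt0.
have lnN := ln_le_powR Nge1.
have q1 : 1 <= N `^ (1 / 4) by rewrite -[leLHS](powRr0 N) ler_powR//; lra.
rewrite -ler_pdivrMr//; move: hM4.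
have -> : B * ln N / (s0 ^+ 2 / 2) = 2 * B / s0 ^+ 2 * ln N.
  by field; rewrite gt_eqF.
have : 0 <= 2 * B / s0 ^+ 2 by apply: divr_ge0; [exact: mulr_ge0|exact: sqr_ge0].
move: (2 * B / s0 ^+ 2) => D D0 hM4.
have hq : (D * 4 + 1) * N `^ (1 / 4) <= a1 / 4 * N `^ (1 / 2).
  have a4 : 0 < 4 / a1 by rewrite divr_gt0.
  have -> : a1 / 4 = (4 / a1)^-1 by rewrite invf_div.
  by rewrite ler_pdivlMl// mulrCA mulrA.
have DL : D * ln N <= D * (4 * N `^ (1 / 4)) by exact: ler_wpM2l.
by move: hq DL xy LS q1; clear; lra.
Qed.

End poisson_energy.

(** * The coefficients of [Pn] and their Poisson squares *)

Section coefficients.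
Variable R : realType.

(* The sum defining [Pn] starts at index 1; the coefficient 0 at index 0 lets
   [wsum] start at index 0. *)
Definition pn_coef (x : R) (i : nat) : R :=
  if i is 0%N then 0 else expR (- x ^+ 2 / 2) * x ^+ i / Num.sqrt i`!%:R.

Lemma Pn_wsum d (T : measurableType d) (P : probability T R)
  (xi : nat -> {RV P >-> R}) n x w : Pn xi n x w = wsum (pn_coef x) xi n.+1 w.
Proof.
rewrite /Pn /wsum -(big_mkord xpredT (fun i => pn_coef x i * xi i w)).
rewrite [RHS]big_ltn//= mul0r add0r mulr_sumr; apply: eq_big_nat => -[//|i] _ /=.
by move: (Num.sqrt _)^-1 => u; ring.
Qed.

Lemma pn_coef_sqr x i : (0 < i)%N -> pn_coef x i ^+ 2 = pois (x ^+ 2) i.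
Proof.
case: i => // i _; rewrite /pn_coef /pois !exprMn exprVn sqr_sqrtr ?ler0n//.
by rewrite -expRM_natl [2%:R * _]mulrC divfK// exprAC.
Qed.

(** Index 0 passes the filter but contributes 0; at the other indices squaring turns the condition
    on the argument into a level for the Poisson weight. *)
Lemma pn_energy (x s0 : R) n m : 0 < s0 -> (0 < m)%N ->
  \sum_(i < n.+1 | `|m%:R * pn_coef x i| <= s0) (m%:R * pn_coef x i) ^+ 2 =
  m%:R ^+ 2 * \sum_(1 <= i < n.+1 | pois (x ^+ 2) i <= (s0 / m%:R) ^+ 2)
     pois (x ^+ 2) i.
Proof.
move=> s00 m0; have mR0 : 0 < m%:R :> R by rewrite ltr0n.
rewrite -(big_mkord (fun i => `|m%:R * pn_coef x i| <= s0)
  (fun i => (m%:R * pn_coef x i) ^+ 2)).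
rewrite big_ltn_cond// mulr0 normr0 ltW// expr0n add0r mulr_sumr.
rewrite big_nat_cond [RHS]big_nat_cond; apply: eq_big => [i|i /andP[/andP[i1 _] _]].
  case: (boolP (_ <= i < _)%N) => //= /andP[i1 _]; rewrite -pn_coef_sqr//.
  rewrite -(real_normK (num_real (pn_coef x i))) normrM normr_nat.
  rewrite ler_sqr ?nnegrE ?mulr_ge0 ?divr_ge0 ?(ltW s00)//.
  by rewrite ler_pdivlMr// mulrC.
by rewrite exprMn pn_coef_sqr.
Qed.

End coefficients.

(** * Assembly of the small ball estimate *)

Unset Implicit Arguments.

Theorem theorem4p1 (R : realType) (C eps_g a1 a2 : R)
  (d : measure_display) (T : measurableType d) (P : probability T R)
  (xi : nat -> {RV P >-> R}) :
  0 < C -> 0 < eps_g -> eps_g < 1 / 2 -> 0 < a1 -> a1 < a2 ->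
  iid xi -> subgaussian (xi 0%N) ->
  ('E_P[xi 0%N] = 0)%E -> variance P (xi 0%N) = 1%E ->
  exists K N0 : R, forall (N : R) (n : nat) (x a : R),
    N0 <= N -> N <= Num.sqrt n%:R ->
    a1 * N <= x -> x <= a2 * N -> x <= Num.sqrt n%:R - N `^ eps_g ->
    (P [set w | (`|Pn xi n x w - a| < N `^ (- C))%R] <= (K * N `^ (- C))%:E)%E.
Proof.
move=> C0 eps0 eps2 a10 _ xi_iid _ E0 V1.
have [c [s0 [c0 s00 near0]]] := chf2_near0 E0 V1.
(* With [B = 2 C / c], an energy of [B ln N] bounds the squared modulus by [N^(-2 C)], hence the
   modulus by [delta]. *)
have B0 : 0 <= 2 * C / c by rewrite divr_ge0 ?mulr_ge0// ltW.
have [N0 N01 energy] := eventually_pois_energy C a2 eps0 eps2 a10 s00 B0.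
(* When the kept mass is at least 1/2, the energy is at least [m^2 / 2 >= m / 2], so the squared
   modulus is at most [e^(-c m / 2)], the square of [r ^+ m]. *)
pose r := expR (- (c / 4)).
have r0 : 0 < r := expR_gt0 _.
have r1 : r < 1 by rewrite expR_lt1 oppr_lt0 divr_gt0.
pose D := 2 / (1 - r) + 1.
have D0 : 0 <= D by rewrite addr_ge0// divr_ge0// subr_ge0 ltW.
have cos1 := @cos1_gt0 R.
exists (D / cos 1 ^+ 2 * 2), N0 => N n x a N0N _ a1x xa2 xn.
have Np : 0 < N by exact: lt_le_trans (lt_le_trans ltr01 N01) N0N.
have Nge1 : 1 <= N by exact: le_trans N01 N0N.
have NC0 : 0 < N `^ C by exact: powR_gt0.
have NC1 : 1 <= N `^ C by rewrite -[leLHS](powRr0 N) ler_powR// ltW.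
pose delta := N `^ (- C).
have deltaE : delta = (N `^ C)^-1 by rewrite /delta powRN.
have delta0 : 0 < delta by exact: powR_gt0.
pose M := Num.truncn (N `^ C).
have MC : M%:R <= N `^ C by rewrite truncn_le// ltW.
have MS : N `^ C < M%:R + 1 by rewrite natr1 truncnS_gt.
have M1 : (1 <= M)%N by rewrite truncn_gt0.
have M0 : 0 < M%:R :> R by rewrite ltr0n.
have Mdelta : M%:R * delta <= 1 by rewrite deltaE ler_pdivrMr// mul1r.
pose g m := r ^+ m + delta.
pose S : {RV P >-> R} := wsum (pn_coef x) xi n.+1.
have char_le m b : (m < M)%N -> `|\int[P]_w cos (m%:R * S w - b)| <= g m.
  move=> mM; have := cos_shift_le S m%:R b.
  have g0 u v : 0 <= u -> 0 <= v -> u ^+ 2 <= v ^+ 2 -> u <= v :> R.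
    by move=> u0 v0; rewrite ler_sqr ?nnegrE.
  (* The energy bound concerns [m > 0]; at frequency 0 the trivial bound suffices, since
     [g 0 >= 1]. *)
  move=> le_chf2; case: (posnP m) => [m0|m0].
    apply: g0 => //; first by rewrite addr_ge0 ?exprn_ge0 ?ltW.
    apply: le_trans le_chf2 _; apply: le_trans (chf2_le1 _ _) _.
    by rewrite /g m0 expr0 exprn_ege1// lerDl ltW.
  have mC : m%:R <= N `^ C by apply: le_trans MC; rewrite ler_nat ltnW.
  have := chf2_wsum_le (pn_coef x) n.+1 m%:R xi_iid near0.
  rewrite pn_energy// => /(le_trans le_chf2){}le_chf2.
  have [W2|WN] := energy N n m x N0N a1x xa2 xn m0 mC.
    apply: (@le_trans _ _ (r ^+ m)); last by rewrite lerDl ltW.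
    apply: g0; [by []|by rewrite exprn_ge0// ltW|].
    apply: le_trans le_chf2 _.
    rewrite /r -expRM_natl -expRM_natl ler_expR.
    have m1 : 1 <= m%:R :> R by rewrite ler1n.
    have mW : m%:R * 2^-1 <= m%:R ^+ 2 * \sum_(1 <= i < n.+1 |
        pois (x ^+ 2) i <= (s0 / m%:R) ^+ 2) pois (x ^+ 2) i.
      by apply: ler_pM => //; [rewrite expr2 ler_peMr//; lra|rewrite -div1r].
    have := ler_wpM2l (ltW c0) mW; lra.
  apply: (@le_trans _ _ delta); last by rewrite lerDr exprn_ge0// ltW.
  apply: g0; [by []|exact: ltW|].
  apply: le_trans le_chf2 _.
  rewrite /delta /powR gt_eqF// -expRM_natl ler_expR.
  have := ler_wpM2l (ltW c0) WN.
  have -> : c * (2 * C / c * ln N) = 2 * C * ln N by field; rewrite gt_eqF.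
  lra.
have := @concentration_le _ _ _ P (wsum (pn_coef x) xi n.+1) a delta M g Mdelta char_le.
have -> : [set w | `|Pn xi n x w - a| < N `^ (- C)] =
    [set w | `|wsum (pn_coef x) xi n.+1 w - a| < delta].
  by apply/seteqP; split => w /=; rewrite Pn_wsum.
set A := [set w | _] => conc.
(* In each row the geometric part gives [2 / (1 - r)] and the constant part [M delta <= 1]; their
   total is [D]. *)
have sum_le : \sum_(j < M) \sum_(k < M) g ((j - k) + (k - j))%N <= M%:R * D.
  have -> : M%:R * D = \sum_(j < M) D by rewrite sumr_const card_ord mulr_natl.
  apply: ler_sum => j _; rewrite big_split /= lerD//.
    rewrite ler_pdivlMr ?subr_gt0// mulrC.
    by apply: two_sided_geometric_sum; rewrite !ltW.
  by rewrite sumr_const card_ord -[_ *+ M]mulr_natl.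
have mA : measurable A by exact: measurable_norm_sub_lt.
rewrite -[P A]fineK ?fin_num_measure// lee_fin.
have := le_trans conc sum_le.
(* One of the two factors [M] cancels against the linear bound, which leaves a probability of order
   [1 / M]. *)
rewrite (_ : _ * _ ^+ 2 = M%:R * (M%:R * (fine (P A) * cos 1 ^+ 2))); last by ring.
rewrite ler_pM2l// -ler_pdivlMl// => PA.
have c2 : 0 < cos 1 ^+ 2 :> R by rewrite exprn_gt0.
apply: (@le_trans _ _ (M%:R^-1 * (D / cos 1 ^+ 2))).
  by rewrite mulrA ler_pdivlMr.
rewrite mulrC -[leRHS]mulrA ler_wpM2l ?divr_ge0 ?(ltW c2)//.
(* Rounding [N^C] down costs at most a factor 2, because [N^C < M + 1 <= 2 M]; this is the last
   factor of the constant. *)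
rewrite -/delta deltaE -[2]invrK -invfM lef_pV2 ?posrE ?mulr_gt0 ?invr_gt0//.
have M1R : 1 <= M%:R :> R by rewrite ler1n.
by rewrite mulrC ler_pdivrMr//; lra.
Qed.
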